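(* Let $G$ be a graph that admits an open XOR-magic labeling, and let $A(G)$ be its adjacency matrix (an integer $0/1$ matrix). Then $\det(A(G))\equiv 0 \pmod 2$.
   Context: All graphs are simple. For a vertex $x$, $N(x)$ is the set of neighbours of $x$. An open XOR-magic labeling of a graph $G=(V,E)$ with $|V|=2^n$ is a bijection $\ell:V\to(\mathbb{Z}_2)^n$ such that $\sum_{y\in N(x)}\ell(y)$ equals the zero vector of $(\mathbb{Z}_2)^n$ for every $x\in V$. *)

(* Defs.v *)
From HB Require Import structures.
From mathcomp Require Import all_boot all_order all_algebra.

Set Implicit Arguments.
Unset Strict Implicit.
Unset Printing Implicit Defensive.

Import GRing.Theory.
Local Open Scope ring_scope.

Record sgraph := SGraph {
  vertex :> finType;
  edge : rel vertex;
  edge_sym : symmetric edge;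
  edge_irrefl : irreflexive edge
}.

Definition nbhd (G : sgraph) (x : G) : {set G} := [set y | edge x y].

Definition open_xor_magic_labeling (G : sgraph) (n : nat)
    (l : G -> 'rV['Z_2]_n) : Prop :=
  [/\ #|G| = (2 ^ n)%N,
      bijective l
    & forall x : G, \sum_(y in nbhd x) l y = 0].

Definition admits_open_xor_magic_labeling (G : sgraph) : Prop :=
  exists (n : nat) (l : G -> 'rV['Z_2]_n), open_xor_magic_labeling l.

Definition adjacency_mx (G : sgraph) : 'M[int]_#|G| :=
  \matrix_(i, j) (edge (enum_val i) (enum_val j))%:R.

(* Main.v *)
Require Import Defs.
From mathcomp Require Import all_boot all_order all_algebra.

Import GRing.Theory.
Local Open Scope ring_scope.

(* Modulo 2 the magic condition says A *m L = 0, where the rows of L are the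
   labels.  If \det A were odd, L would vanish, so by injectivity G would have
   a single vertex and A would be zero. *)

Definition label_mx (G : sgraph) (n : nat) (l : G -> 'rV['Z_2]_n) :
    'M['F_2]_(#|G|, n) := \matrix_i l (enum_val i).

Lemma adjacency_mx_mul_label (G : sgraph) (n : nat) (l : G -> 'rV['Z_2]_n) :
  open_xor_magic_labeling l ->
  map_mx intr (adjacency_mx G) *m label_mx G n l = 0.
Proof.
case=> _ _ magic; apply/row_matrixP => i; rewrite row0 -[RHS](magic (enum_val i)).
(* The neighbourhood sum becomes a sum over all vertices, reindexed by [enum_val] to match row [i]
   of the product. *)
rewrite row_mul mulmx_sum_row [RHS]big_mkcond (reindex (@enum_val _ G)) /=; last first.
  exact/onW_bij/enum_val_bij.
apply: eq_bigr => j _; rewrite rowK !mxE inE.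
by case: edge; rewrite ?scale1r ?scale0r.
Qed.

Theorem theorem3 (G : sgraph) (hG : admits_open_xor_magic_labeling G) :
  (\det (adjacency_mx G) = 0 %[mod 2])%Z.
Proof.
case: hG => n [l hl]; have AL0 := adjacency_mx_mul_label G n l hl.
case: hl => cardG l_bij _.
(* Evenness is vanishing in the field ['F_2], where a nonzero determinant makes the matrix
   invertible. *)
apply/eqP; rewrite eqz_mod_dvd subr0 (dvdz_pcharf (pchar_Fp (isT : prime 2))).
rewrite -det_map_mx; apply: contraT; rewrite -unitfE => detA_unit.
have L0 : label_mx G n l = 0.
  by rewrite -[LHS](mulKmx (detA_unit : _ \in unitmx)) AL0 mulmx0.
have l0 x : l x = 0.
  by rewrite -(enum_rankK x) -[LHS](rowK (fun i => l (enum_val i))) [X in row _ X]L0 row0.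
have A0 : map_mx intr (adjacency_mx G) = 0 :> 'M['F_2]_#|G|.
  apply/matrixP => i j; rewrite !mxE.
  (* All labels agree, so any two vertices coincide and every entry is a diagonal one. *)
  have -> : enum_val i = enum_val j by apply: (bij_inj l_bij); rewrite !l0.
  by rewrite edge_irrefl.
(* This excludes the empty matrix, whose determinant is 1. *)
have: (0 < #|G|)%N by rewrite cardG expn_gt0.
move: detA_unit; rewrite A0.
by case: #|G| => // m; rewrite det0 unitr0.
Qed.
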